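(* Let $N$ be a unitarily invariant norm on $M_n(\mathbb{C})$, let $A\in M_n(\mathbb{C})$ be positive definite and let $X\in M_n(\mathbb{C})$. Then the function $$k(t)=w_N\big(A^{t}XA^{1-t}+A^{-t}XA^{1+t}\big)$$ is convex on $\mathbb{R}$, and its minimum is attained at $t=0$.
   Context: For a norm $N$ on $M_n(\mathbb{C})$ (the $n\times n$ complex matrices), the generalized numerical radius of $Y\in M_n(\mathbb{C})$ is $w_N(Y)=\sup_{\theta\in\mathbb{R}}N(\mathrm{Re}(e^{i\theta}Y))$, where $\mathrm{Re}(Z)=\frac12(Z+Z^* )$. The norm $N$ is unitarily invariant if $N(UYV)=N(Y)$ for all $Y\in M_n(\mathbb{C})$ and all unitary $U,V\in M_n(\mathbb{C})$. For a positive definite (Hermitian) matrix $A$ and $t\in\mathbb{R}$, $A^t$ is defined by the functional calculus. *)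

(* Defs.v *)
From HB Require Import structures.
From mathcomp Require Import all_boot all_order all_algebra.
From mathcomp Require Import sesquilinear spectral.
From mathcomp Require Import complex.
From mathcomp Require Import all_classical all_reals all_analysis.

Set Implicit Arguments.
Unset Strict Implicit.
Unset Printing Implicit Defensive.

Import Order.TTheory GRing.Theory Num.Theory.

Local Open Scope ring_scope.
Local Open Scope complex_scope.
Local Open Scope sesquilinear_scope.
Local Open Scope classical_set_scope.

(* The norm of [R[i]] is itself [R[i]]-valued, hence [Normc.normc], the modulus
   as an element of [R]. *)
Record is_mxnorm (R : realType) (n : nat) (N : 'M[R[i]]_n -> R) : Prop := {
  mxnorm_ge0 : forall Y, 0 <= N Y;
  mxnorm_eq0 : forall Y, N Y = 0 -> Y = 0;
  mxnormZ : forall (c : R[i]) Y, N (c *: Y) = Normc.normc c * N Y;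
  ler_mxnormD : forall Y Z, N (Y + Z) <= N Y + N Z }.

Definition unitarily_invariant (R : realType) (n : nat)
    (N : 'M[R[i]]_n -> R) : Prop :=
  forall U Y V : 'M[R[i]]_n,
    U \is unitarymx -> V \is unitarymx -> N (U *m Y *m V) = N Y.

Definition mxRe (R : realType) (n : nat) (Z : 'M[R[i]]_n) : 'M[R[i]]_n :=
  2^-1 *: (Z + Z ^t*).

Definition expi (R : realType) (theta : R) : R[i] := cos theta +i* sin theta.

Definition numradius (R : realType) (n : nat) (N : 'M[R[i]]_n -> R)
    (Y : 'M[R[i]]_n) : R :=
  sup [set N (mxRe (expi theta *: Y)) | theta in [set: R]].

(* The order of [R[i]] makes [0 < z] mean that [z] is real and positive. *)
Definition posdefmx (R : realType) (n : nat) (A : 'M[R[i]]_n) : Prop :=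
  A \is hermsymmx /\
  forall x : 'cV[R[i]]_n, x != 0 -> 0 < (x ^t* *m A *m x) 0 0.

(* Functional calculus [f(A)] for Hermitian [A], through the unitary
   diagonalization chosen by the library; [mxfunE] below shows that the result
   does not depend on this choice. *)
Definition mxfun (R : realType) (n : nat) (f : R -> R) (A : 'M[R[i]]_n) :
    'M[R[i]]_n :=
  invmx (spectralmx A)
    *m diag_mx (map_mx (fun z : R[i] => (f (complex.Re z))%:C) (spectral_diag A))
    *m spectralmx A.

Definition mxpowR (R : realType) (n : nat) (A : 'M[R[i]]_n) (t : R) :
    'M[R[i]]_n :=
  mxfun (fun x : R => x `^ t) A.

Lemma mxfunE (R : realType) (n : nat) (f : R -> R) (A U : 'M[R[i]]_n)
    (d : 'rV[R[i]]_n) :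
  A \is hermsymmx -> U \is unitarymx -> A = invmx U *m diag_mx d *m U ->
  mxfun f A =
    invmx U *m diag_mx (map_mx (fun z : R[i] => (f (complex.Re z))%:C) d) *m U.
Proof.
move=> /hermitian_normalmx /orthomx_spectralP AP /unitarymx_unit Uu AU.
have Pu := spectral_unit A; rewrite /mxfun.
set P := spectralmx A in AP Pu *; set e := spectral_diag A in AP *.
set g := fun z : R[i] => _.
have H : diag_mx d *m (U *m invmx P) = U *m invmx P *m diag_mx e.
  have : U *m A *m invmx P = U *m A *m invmx P by [].
  by rewrite {1}AU {1}AP !mulmxA mulmxV // mul1mx mulmxK.
have Hg : diag_mx (map_mx g d) *m (U *m invmx P) =
          U *m invmx P *m diag_mx (map_mx g e).
  apply/matrixP => i j; move/matrixP/(_ i j): H.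
  rewrite !mul_diag_mx !mul_mx_diag !mxE => H.
  have [->|Q0] := eqVneq (\sum_j0 U i j0 * invmx P j0 j) 0.
    by rewrite mulr0 mul0r.
  by move: H; rewrite mulrC => /(mulfI Q0) ->; rewrite mulrC.
have Pvu : invmx P \in unitmx by rewrite unitmx_inv.
apply: (can_inj (mulKmx Uu)); apply: (can_inj (mulmxK Pvu)).
by rewrite !mulmxA mulmxK // mulmxV // mul1mx -Hg !mulmxA.
Qed.

Lemma mxpowR0 (R : realType) (n : nat) (A : 'M[R[i]]_n) : mxpowR A 0 = 1%:M.
Proof.
rewrite /mxpowR /mxfun (_ : map_mx _ _ = const_mx 1) ?diag_const_mx.
  by rewrite mulmx1 mulVmx ?spectral_unit.
by apply/matrixP => i j; rewrite !mxE powRr0.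
Qed.

(* The supremum defining [numradius] is over a nonempty bounded set. *)
Lemma numradius_has_sup (R : realType) (n : nat) (N : 'M[R[i]]_n -> R)
    (Y : 'M[R[i]]_n) :
  is_mxnorm N ->
  has_sup [set N (mxRe (expi theta *: Y)) | theta in [set: R]].
Proof.
move=> hN; split; first by exists (N (mxRe (expi 0 *: Y))), 0.
exists (Normc.normc (2^-1 : R[i]) * (N Y + N (Y ^t* ))) => _ [theta _ <-].
rewrite /mxRe (mxnormZ hN) ler_wpM2l //.
  by case: (2^-1 : R[i]) => a b; rewrite sqrtr_ge0.
have e1 : Normc.normc (expi theta) = 1 by rewrite /= cos2Dsin2 sqrtr1.
have e2 : Normc.normc (expi theta)^*%C = 1.
  by rewrite /= sqrrN cos2Dsin2 sqrtr1.
have -> : (expi theta *: Y) ^t* = (expi theta)^*%C *: Y ^t*.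
  by apply/matrixP => i j; rewrite !mxE rmorphM.
by apply: (le_trans (ler_mxnormD hN _ _)); rewrite !(mxnormZ hN) e1 e2 !mul1r.
Qed.

(* Main.v *)
Require Import Defs.
From mathcomp Require Import all_boot all_order all_algebra.
From mathcomp Require Import sesquilinear spectral complex.
From mathcomp Require Import all_classical all_reals all_analysis.
From mathcomp Require Import perm ring lra.

Import Order.TTheory GRing.Theory Num.Theory.
Local Open Scope ring_scope.
Local Open Scope classical_set_scope.

(** With [H] the real part of [e^(i theta) X A], the matrix under the norm in the
    definition of [k t] is [Z t = A^t H A^-t + A^-t H A^t], which is Hermitian
    and satisfies [A^s (Z t) A^-s + A^-s (Z t) A^s = Z (t + s) + Z (t - s)].
    For [K] Hermitian and [S] positive definite one has
    [2 N K <= N (S K S^-1 + S^-1 K S)]: the matrix [S K S^-1] has the real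
    eigenvalues of [K], so after a unitary triangularization they form the
    diagonal of its real part, and [N] decreases when a matrix is reduced to its
    diagonal, which is an average of unitary conjugates.  Hence
    [t |-> N (Z t)] is even, midpoint convex and locally bounded, therefore
    convex with its minimum at [0]; these properties pass to the supremum over
    [theta]. *)

(** * Midpoint convex functions bounded on intervals *)

(** Subtracting the chord leaves [g], midpoint convex, bounded above on [0, 1] and zero at both
    ends; [sup G] is then at most its own half, so [g] is nonpositive. *)
Lemma midconvex_bounded_convex (R : realType) (f : R -> R) :
  (forall t s, 2 * f t <= f (t + s) + f (t - s)) ->
  (forall c, exists M, forall t, `|t| <= c -> f t <= M) ->
  forall l x y, 0 <= l <= 1 ->
    f (l * x + (1 - l) * y) <= l * f x + (1 - l) * f y.
Proof.
move=> midf bndf l x y l01.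
pose g u := f (u * x + (1 - u) * y) - (u * f x + (1 - u) * f y).
suff g_le0 : forall u, 0 <= u <= 1 -> g u <= 0 by rewrite -subr_le0; exact: g_le0.
have midg u v : 2 * g u <= g (u + v) + g (u - v).
  (* The step v (x - y) shifts the parameter by [v]; the chord is affine and cancels. *)
  have := midf (u * x + (1 - u) * y) (v * (x - y)).
  have -> : u * x + (1 - u) * y + v * (x - y) =
            (u + v) * x + (1 - (u + v)) * y by ring.
  have -> : u * x + (1 - u) * y - v * (x - y) =
            (u - v) * x + (1 - (u - v)) * y by ring.
  rewrite /g; lra.
have g0 : g 0 = 0 by rewrite /g !mul0r !add0r subr0 !mul1r subrr.
have g1 : g 1 = 0 by rewrite /g !mul1r subrr !mul0r !addr0 subrr.
pose G := [set g u | u in [set u | 0 <= u <= 1]].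
have G0 : G !=set0 by exists (g 0), 0 => //=; rewrite lexx ler01.
have ubG : has_ubound G.
  (* Convex combinations of [x] and [y] have modulus at most |x| + |y|, and the chord is at least
     -|f x| - |f y|. *)
  have [M fM] := bndf (`|x| + `|y|).
  exists (M + `|f x| + `|f y|) => _ [v /= /andP[v0 v1] <-].
  have fle : f (v * x + (1 - v) * y) <= M.
    apply: fM; rewrite (le_trans (ler_normD _ _))// !normrM.
    rewrite (ger0_norm v0) (@ger0_norm _ (1 - v)) ?subr_ge0//.
    by apply: lerD; rewrite ler_piMl ?subr_ge0 ?gerBl.
  have h1 : - `|f x| <= v * f x.
    have : `|v * f x| <= `|f x| by rewrite normrM ger0_norm// ler_piMl.
    by rewrite ler_norml => /andP[].
  have h2 : - `|f y| <= (1 - v) * f y.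
    have : `|(1 - v) * f y| <= `|f y|.
      by rewrite normrM ger0_norm ?subr_ge0// ler_piMl// gerBl.
    by rewrite ler_norml => /andP[].
  rewrite /g; lra.
have gle v : 0 <= v <= 1 -> g v <= sup G.
  by move=> v01; apply: ub_le_sup => //; exists v.
(* Reflecting an endpoint (where [g] vanishes) through [v] halves any bound. *)
have gle2 v : 0 <= v <= 1 -> g v <= sup G / 2.
  move=> /andP[v0 v1]; have [v2|v2] := leP v (1/2).
    have := midg v v; rewrite subrr g0.
    have := gle (v + v) ltac:(apply/andP; split; lra); lra.
  have := midg v (1 - v); rewrite subrKC g1.
  have := gle (v - (1 - v)) ltac:(apply/andP; split; lra); lra.
have S0 : sup G <= sup G / 2 by apply: ge_sup => // _ [v v01 <-]; exact: gle2.
move=> u /gle; lra.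
Qed.

(** * Similarity, diagonals and unitarily invariant norms *)

(** [P] also intertwines the characteristic matrices over polynomials, and its determinant, a
    nonzero constant, cancels. *)
Lemma char_poly_similar (F : fieldType) (n : nat) (P A B : 'M[F]_n) :
  P \in unitmx -> P *m A = B *m P -> char_poly A = char_poly B.
Proof.
move=> Pu PA.
have PA' : map_mx polyC P *m char_poly_mx A = char_poly_mx B *m map_mx polyC P.
  by rewrite /char_poly_mx mulmxBr mulmxBl -!map_mxM PA scalar_mxC.
have detP : \det (map_mx polyC P) != 0.
  by rewrite det_map_mx polyC_eq0 -unitfE -unitmxE.
by apply: (mulfI detP); rewrite /char_poly -det_mulmx PA' det_mulmx mulrC.
Qed.

Section UnitarilyInvariantNorm.
Local Open Scope complex_scope.
Local Open Scope sesquilinear_scope.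
Context {R : realType} {n : nat}.
Implicit Types (N : 'M[R[i]]_n -> R) (A H K P S T Y Z : 'M[R[i]]_n).

Lemma trmxC_mul Y Z : (Y *m Z) ^t* = Z ^t* *m Y ^t*.
Proof. by rewrite trmx_mul map_mxM. Qed.

Lemma trmxC_add Y Z : (Y + Z) ^t* = Y ^t* + Z ^t*.
Proof. by apply/matrixP => i j; rewrite !mxE rmorphD. Qed.

Lemma mxRe_conj P Z : mxRe (P *m Z *m P ^t*) = P *m mxRe Z *m P ^t*.
Proof.
by rewrite /mxRe !trmxC_mul trmxCK -scalemxAr -scalemxAl mulmxDr mulmxDl !mulmxA.
Qed.

Lemma trmxC_mxRe Z : (mxRe Z) ^t* = mxRe Z.
Proof.
apply/matrixP => i j; rewrite !mxE rmorphM rmorphD /= conjCK addrC.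
by rewrite fmorphV rmorph_nat.
Qed.

(** The permutation matching the two diagonals gives a unitary matrix, and conjugating by it carries
    one diagonal matrix to the other. *)
Lemma norm_diag_perm N (d e : 'rV[R[i]]_n) : unitarily_invariant N ->
  perm_eq [seq d 0 i | i : 'I_n] [seq e 0 i | i : 'I_n] ->
  N (diag_mx d) = N (diag_mx e).
Proof.
move=> hU; rewrite -[X in perm_eq _ X]/(tval [tuple e 0 i | i < n]).
move=> /tuple_permP[s]; rewrite -[LHS]/(tval [tuple d 0 i | i < n]).
move=> /val_inj ds; have dE i : d 0 i = e 0 (s i).
  by have /(congr1 (fun t => tnth t i)) := ds; rewrite !tnth_mktuple.
have sU : perm_mx s \is @unitarymx R[i] n n.
  by apply/unitarymxP; rewrite tr_perm_mx map_perm_mx -perm_mxM mulgV perm_mx1.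
rewrite -(hU (perm_mx s) (diag_mx e) ((perm_mx s)^t*)) ?trmxC_unitary//.
congr N; rewrite tr_perm_mx map_perm_mx -row_permE -col_permE.
by apply/matrixP => i j; rewrite !mxE dE (inj_eq perm_inj).
Qed.

(** The index list allows an induction: the empty list gives [Y], the full list its diagonal
    part. *)
Definition pinching_mx (s : seq 'I_n) Y : 'M[R[i]]_n :=
  \matrix_(i, j) if (i != j) && ((i \in s) || (j \in s)) then 0 else Y i j.

Lemma normc_real (a : R) : 0 <= a -> Normc.normc a%:C = a.
Proof. by move=> a0; rewrite /= expr0n addr0 sqrtr_sqr ger0_norm. Qed.

Lemma normc_half : Normc.normc (2^-1 : R[i]) = 2^-1.
Proof.
by rewrite Normc.normcV -(rmorph_nat (real_complex R)) normc_real.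
Qed.

(* Conjugating by the reflection that negates the [k]-th basis vector and
   averaging kills the off-diagonal entries of row and column [k]. *)
Lemma norm_pinching N s Y : is_mxnorm N -> unitarily_invariant N ->
  N (pinching_mx s Y) <= N Y.
Proof.
move=> hN hU; elim: s => [|k s IHs].
  rewrite (_ : pinching_mx [::] Y = Y)//.
  by apply/matrixP => i j; rewrite mxE andbF.
pose D : 'M[R[i]]_n := diag_mx (\row_i (-1) ^+ (i == k)).
have DU : D \is unitarymx.
  apply/unitarymxP/matrixP => i j.
  rewrite mul_diag_mx !mxE; have [->|_] := eqVneq j i; last first.
    by rewrite mulr0n rmorph0 mulr0.
  by rewrite mulr1n rmorph_sign -signr_addb addbb.
have -> : pinching_mx (k :: s) Y =
    2^-1 *: (pinching_mx s Y + D *m pinching_mx s Y *m D).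
  apply/matrixP => i j.
  rewrite mul_mx_diag [in RHS]mxE mxE mul_diag_mx !mxE !inE.
  have halfD (z : R[i]) : z = 2^-1 * (z + z) by field.
  have [->|ij] /= := eqVneq i j.
    by rewrite mulrAC -signr_addb addbb mul1r -halfD.
  have [_|_] := boolP (i \in s); first by rewrite orbT mulr0 mul0r addr0 mulr0.
  have [_|_] := boolP (j \in s).
    by rewrite !orbT mulr0 mul0r addr0 mulr0.
  rewrite !orbF; have [ik|_] := eqVneq i k.
    rewrite ik in ij; rewrite eq_sym (negPf ij) expr0 mulr1 expr1 mulN1r subrr.
    by rewrite mulr0.
  case: eqP => _; rewrite expr0 mul1r ?mulr1 -?halfD//.
  by rewrite expr1 mulrN1 subrr mulr0.
rewrite (mxnormZ hN) normc_half ler_pdivrMl ?ltr0n//.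
rewrite (le_trans (ler_mxnormD hN _ _))// hU//; lra.
Qed.

Lemma norm_diag_le N Y : is_mxnorm N -> unitarily_invariant N ->
  N (diag_mx (\row_i Y i i)) <= N Y.
Proof.
move=> hN hU; apply: le_trans (norm_pinching N (enum 'I_n) Y hN hU).
rewrite (_ : diag_mx _ = pinching_mx (enum 'I_n) Y)//; apply/matrixP => i j.
by rewrite !mxE !mem_enum /= andbT; case: eqVneq => [->|].
Qed.

(* [S K S^-1] has the real spectrum of [K], which a Schur triangularization
   puts on the diagonal of its real part. *)
Lemma norm_le_mxRe_similar N K S : is_mxnorm N -> unitarily_invariant N ->
  K \is hermsymmx -> S \in unitmx -> N K <= N (mxRe (S *m K *m invmx S)).
Proof.
move=> hN hU hK Su; set M := S *m K *m invmx S.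
(* [Schur] requires a positive size; in size 0 all matrices are equal. *)
have [n0|n_gt0] := posnP n.
  have eq0 Y Z : Y = Z.
    by apply/matrixP => i; have := ltn_ord i; rewrite [X in (_ < X)%N]n0.
  by rewrite (eq0 K (mxRe M)).
have [P PU] := Schur M n_gt0.
rewrite /similar_to (conjymx M PU); set T := P *m M *m P ^t* => trigT.
have <- : N (mxRe T) = N (mxRe M) by rewrite mxRe_conj hU// trmxC_unitary.
have /orthomx_spectralP KE := hermitian_normalmx hK.
set Q := spectralmx K in KE; set d := spectral_diag K in KE.
have QU : Q \is unitarymx := spectral_unitarymx K.
have Qu := unitarymx_unit QU.
have -> : N K = N (diag_mx d).
  by rewrite KE hU// invmx_unitary// trmxC_unitary.
(* An invertible matrix intertwines [diag_mx d] and [T], so their characteristic polynomials agree;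
   both being triangular, their diagonals agree up to order. *)
have sim : (P *m S *m invmx Q) *m diag_mx d = T *m (P *m S *m invmx Q).
  have TP : T *m P = P *m M by rewrite /T mulmxKtV.
  rewrite !mulmxA TP /M !mulmxA mulmxKV//.
  rewrite -!(mulmxA (P *m S)); congr (_ *m _).
  by rewrite [in RHS]KE mulmxK.
clearbody T; have char_eq : char_poly (diag_mx d) = char_poly T.
  apply: char_poly_similar sim.
  by rewrite !unitmx_mul unitmx_inv Su unitarymx_unit.
have diag_eq : perm_eq [seq d 0 i | i : 'I_n] [seq T i i | i : 'I_n].
  apply: prod_XsubC_eq; rewrite !big_image /=.
  move: char_eq; rewrite !char_poly_trig ?diag_mx_is_trig// => <-.
  by apply: eq_bigr => i _; rewrite mxE eqxx mulr1n.
rewrite (norm_diag_perm N d (\row_i T i i) hU); last first.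
  by under [X in perm_eq _ X]eq_map => i do rewrite mxE.
apply: le_trans (norm_diag_le N _ hN hU).
rewrite (_ : \row_i T i i = \row_i mxRe T i i)//.
apply/rowP => i; rewrite !mxE.
(* Every [T i i] is some [d 0 j], real because [K] is Hermitian, so taking the real part keeps
   it. *)
have : T i i \in [seq d 0 j | j : 'I_n].
  by rewrite (perm_mem diag_eq); apply: map_f; rewrite mem_enum.
move=> /mapP[j _ ->].
have /mxOverP/(_ 0 j)/CrealP -> := hermitian_spectral_diag_real hK.
by field.
Qed.

(** * Powers of a positive definite matrix *)

(** The i-th eigenvalue is the value of the quadratic form of [A] at a unit eigenvector, the adjoint
    of row i of the diagonalizing unitary. *)
Lemma posdefmx_spectral_diag_gt0 A i : posdefmx A -> 0 < spectral_diag A 0 i.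
Proof.
move=> [hA posA]; have /orthomx_spectralP AE := hermitian_normalmx hA.
have PU := spectral_unitarymx A.
set P := spectralmx A in AE PU; set d := spectral_diag A in AE *.
have Pu := unitarymx_unit PU.
have dE : diag_mx d = P *m A *m P ^t*.
  by rewrite -invmx_unitary// [in RHS]AE !mulmxA mulmxV// mul1mx mulmxK.
have x0 : (row i P) ^t* != 0.
  apply: contraTneq isT => /(congr1 (fun v => (row i P *m v) 0 0)).
  have := row_unitarymxP PU i i.
  by rewrite dotmxE eqxx => -> /eqP; rewrite mulmx0 mxE oner_eq0.
have := posA _ x0; rewrite trmxCK.
suff -> : row i P *m A *m (row i P) ^t* = (d 0 i)%:M by rewrite mxE eqxx.
apply/matrixP => u v; rewrite !ord1.
have dii : d 0 i = (P *m A *m P ^t*) i i by rewrite -dE mxE eqxx mulr1n.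
rewrite [RHS]mxE eqxx mulr1n dii -row_mul [LHS]mxE [RHS]mxE.
by apply: eq_bigr => k _; rewrite !mxE.
Qed.

Lemma mxpowRE A t : mxpowR A t = (spectralmx A) ^t* *m
  diag_mx (\row_i (complex.Re (spectral_diag A 0 i) `^ t)%:C) *m spectralmx A.
Proof.
rewrite /mxpowR /mxfun (invmx_unitary (spectral_unitarymx A)).
rewrite (_ : map_mx _ _ =
  \row_i (complex.Re (spectral_diag A 0 i) `^ t)%:C) //.
by apply/rowP => i; rewrite !mxE.
Qed.

Lemma trmxC_mxpowR A t : (mxpowR A t) ^t* = mxpowR A t.
Proof.
rewrite mxpowRE !trmxC_mul trmxCK mulmxA; congr (_ *m _ *m _).
apply/matrixP => i j; rewrite !mxE; have [->|ij] := eqVneq i j.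
  by rewrite !mulr1n; apply/eqP; rewrite eq_complex /= oppr0 !eqxx.
by rewrite !mulr0n rmorph0.
Qed.

Lemma mxpowRD A s t : posdefmx A ->
  mxpowR A (s + t) = mxpowR A s *m mxpowR A t.
Proof.
move=> hA; rewrite !mxpowRE; have PU := spectral_unitarymx A.
set P := spectralmx A in PU *.
rewrite !mulmxA (mulmxtVK _ PU).
rewrite -[in RHS](mulmxA _ (diag_mx _) (diag_mx _)) mulmx_diag.
congr (_ *m diag_mx _ *m _); apply/rowP => i; rewrite !mxE -rmorphM powRD//.
(* The exponent law asks for a nonzero base when s + t = 0, as 0^0 = 1. *)
have := posdefmx_spectral_diag_gt0 A i hA.
by rewrite ltcE /= => /andP[_ /gt_eqF ->]; rewrite implybT.
Qed.

Lemma mxpowRVl A t : posdefmx A -> mxpowR A (- t) *m mxpowR A t = 1%:M.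
Proof. by move=> hA; rewrite -mxpowRD// addNr mxpowR0. Qed.

Lemma invmx_mxpowR A t : posdefmx A -> invmx (mxpowR A t) = mxpowR A (- t).
Proof.
move=> hA; have [_ Au] := mulmx1_unit (mxpowRVl A t hA).
by rewrite -[LHS]mul1mx -(mxpowRVl A t hA) mulmxK.
Qed.

(** * The matrix hyperbolic cosine and its norm *)

(** For A = exp L this is 2 cosh(t ad L) applied to [H], with ad L the commutator with L. *)
Definition mxcosh A H t :=
  mxpowR A t *m H *m mxpowR A (- t) + mxpowR A (- t) *m H *m mxpowR A t.

Lemma mxcoshN A H t : mxcosh A H (- t) = mxcosh A H t.
Proof. by rewrite /mxcosh opprK; move: (mxpowR A) => p; rewrite addrC. Qed.

Lemma mxcosh_herm A H t : H ^t* = H -> mxcosh A H t \is hermsymmx.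
Proof.
move=> hH; apply/is_hermitianmxP; rewrite expr0 scale1r /mxcosh.
move: (trmxC_mxpowR A t) (trmxC_mxpowR A (- t)).
move: (mxpowR A t) (mxpowR A (- t)) => a b ha hb.
by rewrite trmxC_add !trmxC_mul ha hb hH addrC !mulmxA.
Qed.

(** This is 4 cosh s cosh t = 2 cosh(t + s) + 2 cosh(t - s), expanded with the exponent law. *)
Lemma mxcosh_comp A H s t : posdefmx A ->
  mxcosh A (mxcosh A H t) s = mxcosh A H (t + s) + mxcosh A H (t - s).
Proof.
move=> hA; have := fun u v => mxpowRD A u v hA; rewrite /mxcosh.
move: (mxpowR A) => p pD; rewrite !mulmxDr !mulmxDl !mulmxA -!pD.
rewrite -!(mulmxA _ (p _) (p _)) -!pD !opprD !opprK.
rewrite (addrC s t) (addrC s (- t)) (addrC (- s) t) (addrC (- s) (- t)).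
set a := _ *m H *m _; set b := _ *m H *m _; set c := _ *m H *m _.
set d := _ *m H *m _.
by rewrite addrACA [b + d]addrC addrACA.
Qed.

(** As [K] and the powers of [A] are Hermitian, [mxcosh A K t] is twice the real part of A^t K
    A^(-t), which is similar to [K]. *)
Lemma norm_mxcosh_ge N A K t : is_mxnorm N -> unitarily_invariant N ->
  posdefmx A -> K \is hermsymmx -> 2 * N K <= N (mxcosh A K t).
Proof.
move=> hN hU hA hK; have [_ Au] := mulmx1_unit (mxpowRVl A t hA).
have := norm_le_mxRe_similar N K (mxpowR A t) hN hU hK Au.
have /is_hermitianmxP := hK; rewrite expr0 scale1r => hK'.
rewrite invmx_mxpowR// /mxcosh.
move: (trmxC_mxpowR A t) (trmxC_mxpowR A (- t)).
move: (mxpowR A t) (mxpowR A (- t)) => a b ha hb.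
rewrite /mxRe !trmxC_mul ha hb -hK' mulmxA.
by rewrite (mxnormZ hN) normc_half ler_pdivlMl.
Qed.

Lemma norm_mxcosh_mid N A H s t : is_mxnorm N -> unitarily_invariant N ->
  posdefmx A -> H ^t* = H ->
  2 * N (mxcosh A H t) <= N (mxcosh A H (t + s)) + N (mxcosh A H (t - s)).
Proof.
move=> hN hU hA hH; apply: le_trans (ler_mxnormD hN _ _).
by rewrite -mxcosh_comp//; apply: norm_mxcosh_ge => //; exact: mxcosh_herm.
Qed.

Lemma norm_le_entries N Y : is_mxnorm N ->
  N Y <= \sum_i \sum_j Normc.normc (Y i j) * N (delta_mx i j).
Proof.
move=> hN; have N0 : N 0 = 0.
  by rewrite -(scale0r (0 : 'M[R[i]]_n)) (mxnormZ hN) Normc.normc0 mul0r.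
have Nsum (F : 'I_n -> 'M[R[i]]_n) : N (\sum_i F i) <= \sum_i N (F i).
  apply: (big_ind2 (fun y z => N y <= z)) => //; first by rewrite N0.
  move=> Y1 z1 Y2 z2 h1 h2.
  exact: le_trans (ler_mxnormD hN _ _) (lerD h1 h2).
rewrite {1}(matrix_sum_delta Y) (le_trans (Nsum _))//; apply: ler_sum => k _.
rewrite (le_trans (Nsum _))//; apply: ler_sum => j _.
by rewrite (mxnormZ hN).
Qed.

Lemma powR_le_expR (x c t : R) : 0 < x -> `|t| <= c ->
  x `^ t <= expR (c * `|ln x|).
Proof.
move=> x0 tc; rewrite /powR gt_eqF// ler_expR (le_trans (ler_norm _))// normrM.
by rewrite ler_wpM2r.
Qed.

Lemma mxpowR_conj_bounded N A H (c : R) :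
  is_mxnorm N -> unitarily_invariant N -> posdefmx A ->
  exists M, forall t, `|t| <= c ->
    N (mxpowR A t *m H *m mxpowR A (- t)) <= M.
Proof.
move=> hN hU hA; have PU := spectral_unitarymx A.
have d_gt0 i : 0 < complex.Re (spectral_diag A 0 i).
  by have := posdefmx_spectral_diag_gt0 A i hA; rewrite ltcE => /andP[].
(* [e i] bounds d_i^t and d_i^(-t) for |t| <= c; in an eigenbasis of [A] the entry (i, j) is d_i^t
   H'_ij d_j^(-t). *)
pose e i := expR (c * `|ln (complex.Re (spectral_diag A 0 i))|).
pose H' := spectralmx A *m H *m (spectralmx A) ^t*.
exists (\sum_i \sum_j e i * e j * Normc.normc (H' i j) * N (delta_mx i j)).
move=> t tc; rewrite !mxpowRE; move: PU @H'.
move: (spectralmx A) => P PU H'.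
set D := diag_mx _; set D' := diag_mx _.
have -> : P ^t* *m D *m P *m H *m (P ^t* *m D' *m P) =
          P ^t* *m (D *m H' *m D') *m P by rewrite /H' !mulmxA.
rewrite hU ?trmxC_unitary//; apply: le_trans (norm_le_entries N _ hN) _.
apply: ler_sum => i _; apply: ler_sum => j _; apply: ler_wpM2r.
  exact: mxnorm_ge0.
rewrite mul_mx_diag mxE mul_diag_mx [X in Normc.normc (X * _)]mxE.
rewrite [X in X * H' i j]mxE [X in _ * X]mxE !Normc.normcM.
rewrite !normc_real ?powR_ge0// mulrAC ler_wpM2r//.
  by case: (H' i j) => x y; rewrite sqrtr_ge0.
by apply: ler_pM; rewrite ?powR_ge0// powR_le_expR// normrN.
Qed.

Lemma norm_mxcosh_bounded N A H (c : R) :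
  is_mxnorm N -> unitarily_invariant N -> posdefmx A ->
  exists M, forall t, `|t| <= c -> N (mxcosh A H t) <= M.
Proof.
move=> hN hU hA; have [M MP] := mxpowR_conj_bounded N A H c hN hU hA.
exists (M + M) => t tc; rewrite /mxcosh (le_trans (ler_mxnormD hN _ _))//.
by apply: lerD; [exact: MP | rewrite -{2}[t]opprK MP// normrN].
Qed.

Lemma norm_mxcosh_convex N A H : is_mxnorm N -> unitarily_invariant N ->
  posdefmx A -> H ^t* = H -> forall l x y, 0 <= l <= 1 ->
  N (mxcosh A H (l * x + (1 - l) * y)) <=
  l * N (mxcosh A H x) + (1 - l) * N (mxcosh A H y).
Proof.
move=> hN hU hA hH; apply: midconvex_bounded_convex => [t s|c].
  exact: norm_mxcosh_mid.
exact: norm_mxcosh_bounded.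
Qed.

(** * Passage to the supremum over theta *)

(** Splitting A^(1-t) = A A^(-t) and A^(1+t) = A A^t exposes two conjugations of X A; adjoints
    exchange their outer factors, so the real part moves inside. *)
Lemma mxRe_mxcosh A X (z : R[i]) t : posdefmx A ->
  mxRe (z *: (mxpowR A t *m X *m mxpowR A (1 - t) +
              mxpowR A (- t) *m X *m mxpowR A (1 + t))) =
  mxcosh A (mxRe (z *: (X *m mxpowR A 1))) t.
Proof.
move=> hA; rewrite (mxpowRD A 1 t hA) (mxpowRD A 1 (- t) hA) /mxcosh.
move: (trmxC_mxpowR A t) (trmxC_mxpowR A (- t)).
move: (mxpowR A t) (mxpowR A (- t)) (mxpowR A 1) => a b p ha hb.
have zE u v : z *: (u *m X *m (p *m v)) = u *m (z *: (X *m p)) *m v.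
  by rewrite -scalemxAr -scalemxAl !mulmxA.
rewrite scalerDr !zE.
move: (z *: (X *m p)) => Y.
rewrite /mxRe trmxC_add !trmxC_mul ha hb !mulmxA.
rewrite -!scalemxAr -!scalemxAl -scalerDr !mulmxDr !mulmxDl.
congr (_ *: _); rewrite addrACA [X in _ + X = _]addrC addrACA.
by rewrite [_ + b *m _ *m _]addrC.
Qed.

Lemma numradius_ge N Y theta : is_mxnorm N ->
  N (mxRe (expi theta *: Y)) <= numradius N Y.
Proof.
move=> hN; have [_ ub] := numradius_has_sup Y hN.
by apply: ub_le_sup => //; exists theta.
Qed.

Lemma numradius_le N Y c : is_mxnorm N ->
  (forall theta, N (mxRe (expi theta *: Y)) <= c) -> numradius N Y <= c.
Proof.
move=> hN Yc; have [ne _] := numradius_has_sup Y hN.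
by apply: ge_sup => // _ [theta _ <-].
Qed.

End UnitarilyInvariantNorm.

Theorem mainTheorem8 (R : realType) (n : nat) (N : 'M[R[i]]_n -> R)
    (A X : 'M[R[i]]_n) (hN : is_mxnorm N) (hU : unitarily_invariant N)
    (hA : posdefmx A) :
  let k : R -> R := fun t =>
    numradius N (mxpowR A t *m X *m mxpowR A (1 - t)
                 + mxpowR A (- t) *m X *m mxpowR A (1 + t)) in
  convex_function (E := R^o) [set: R] k /\ (forall t : R, k 0 <= k t).
Proof.
move=> k; pose H theta := mxRe (expi theta *: (X *m mxpowR A 1)).
have hH theta := trmxC_mxRe (expi theta *: (X *m mxpowR A 1)).
(* Together with [kle] this makes [k t] the least upper bound over theta, so both claims reduce to a
   fixed theta. *)
have kge t theta : N (mxcosh A (H theta) t) <= k t.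
  by rewrite -mxRe_mxcosh//; exact: numradius_ge.
have kle t c : (forall theta, N (mxcosh A (H theta) t) <= c) -> k t <= c.
  move=> tc; apply: numradius_le => // theta.
  by rewrite mxRe_mxcosh//; exact: tc.
split=> [l x y _ _|t].
  apply: kle => theta.
  have l01 : 0 <= l%:num <= 1 by apply/andP.
  apply: le_trans (norm_mxcosh_convex _ _ _ hN hU hA (hH theta) _ x y l01) _.
  have /andP[l0 l1] := l01; have l1' : 0 <= 1 - l%:num by rewrite subr_ge0.
  rewrite convRE.
  exact: lerD (ler_wpM2l l0 (kge x theta)) (ler_wpM2l l1' (kge y theta)).
apply: kle => theta.
(* Midpoint convexity at center 0 with step [t]; by evenness the two outer values coincide. *)
have := norm_mxcosh_mid N A (H theta) t 0 hN hU hA (hH theta).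
rewrite add0r sub0r mxcoshN mulr_natl -mulr2n ler_pMn2r// => /le_trans; apply.
exact: kge.
Qed.
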